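(* Consider the converter system $$\dot\theta=\eta v_{dc},\qquad C_{dc}\dot v_{dc}=-G_{dc}v_{dc}+i_{dc}-\tfrac12m_{\alpha\beta}(\theta)^\top i_{\alpha\beta},$$ $$L\,\dot i_{\alpha\beta}=-R\,i_{\alpha\beta}-v_{\alpha\beta}+\tfrac12m_{\alpha\beta}(\theta)v_{dc},\qquad C\,\dot v_{\alpha\beta}=-G\,v_{\alpha\beta}+i_{\alpha\beta}-i_l,$$ with $m_{\alpha\beta}(\theta)=\mu\begin{bmatrix}-\sin\theta\\\cos\theta\end{bmatrix}$ and $i_{dc}=i_{dc,\mathrm{ref}}-K_p(v_{dc}-v_{dc,\mathrm{ref}})$. Define $i_0=i_{dc,\mathrm{ref}}+K_pv_{dc,\mathrm{ref}}$, and let $r_x,\omega_x,P_x,Q_x$ be the steady-state switching-node voltage amplitude, frequency, active power and reactive power defined in the context. The following hold at steady state. 1. (Nose curves) The amplitude $r_x$ has the following expression as a function of $i_0$ and $P_x$: $$r_x=\frac{\mu}{4(G_{dc}+K_p)}\Bigl(i_0\pm\sqrt{i_0^2-4(G_{dc}+K_p)P_x}\Bigr),$$ with a similar expression for the frequency, $\omega_x=\tfrac{2\eta}{\mu}r_x$. Moreover, the reactive power $Q_x$ and the quantities $r_x,\omega_x$ are not related, i.e. the steady-state equations, with the load current $i_l$ left free, impose no relation between $Q_x$ and $r_x,\omega_x$. 2. (Droop behavior) Around the operating point $\omega_x$, the frequency droop coefficient $d_\omega=\partial P_x/\partial\omega_x$ is $$d_\omega=-\frac{2(G_{dc}+K_p)}{\eta^2}\,\omega_x+\frac{i_0}{\eta},$$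 with an analogous expression for the amplitude droop coefficient $d_r=\partial P_x/\partial r_x$, obtained through $r_x=\tfrac{\mu}{2\eta}\omega_x$. 3. (Power sharing) Consider a pair of such converters $i$ and $j$ with $G_{dc}=0$, identical DC-side voltage references $v_{dc,\mathrm{ref}}>0$ and identical gain $\eta>0$, at a steady state with a common frequency $\omega_x$. The converters achieve proportional power sharing at ratio $\rho=P_{x,i}/P_{x,j}>0$ if $$K_{p,i}=\rho K_{p,j},\qquad i_{dc,\mathrm{ref},i}=\rho\,i_{dc,\mathrm{ref},j},$$ or equivalently if $d_{\omega,i}=\rho\,d_{\omega,j}$ and $P_{dc,i}=\rho P_{dc,j}$, where $P_{dc}=v_{dc,\mathrm{ref}}\cdot i_{dc,\mathrm{ref}}$.
   Context: The parameters $C_{dc},G_{dc},L,R,C,G,\eta,K_p,i_{dc,\mathrm{ref}},v_{dc,\mathrm{ref}}>0$ and $\mu\in(0,1]$ are constants (with $G_{dc}=0$ in item 3). $\theta\in\mathbb{S}^1$, $v_{dc}\in\mathbb{R}$, $i_{\alpha\beta},v_{\alpha\beta}\in\mathbb{R}^2$, and $i_l\in\mathbb{R}^2$ is the load current. $\boldsymbol{J}=\begin{bmatrix}0&-1\\1&0\end{bmatrix}$. A steady state is a solution with constant $v_{dc}=v_{dc}^*$, $\dot\theta=\omega^*=\eta v_{dc}^*$, and sinusoidal AC quantities $z_{\alpha\beta}^\star$ satisfying $\dot z_{\alpha\beta}^\star=\omega^*\boldsymbol{J}z_{\alpha\beta}^\star$. The switching-node voltage is $v_x=\tfrac12m_{\alpha\beta}v_{dc}$.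 At steady state, $r_x=\tfrac12\mu v_{dc}^*$ and $\omega_x=\omega^*=\eta v_{dc}^*$ are its amplitude and frequency, and $P_x=v_x^{\star\top}i_{\alpha\beta}^\star$ and $Q_x=v_x^{\star\top}\boldsymbol{J}^\top i_{\alpha\beta}^\star$ are the active and reactive powers flowing from the switching node, assumed constant. Subscripts $i,j$ refer to quantities of converters $i,j$. Two converters $i,j$ achieve proportional power sharing at ratio $\rho>0$ if $P_{x,i}/P_{x,j}=\rho$.
   Formalization: In item 3 the equivalence with droop coefficients compared only at ω_x assumes ω_x ≠ η·v_dc,ref/2, where it fails; if they are compared on a neighbourhood of ω_x nothing is added. In item 1, Q_x is unrelated to r_x, ω_x for r_x ≠ 0, since r_x = 0 forces Q_x = 0. *)

(* Defs.v *)
From Stdlib Require Import Reals.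
From Coquelicot Require Import Coquelicot.
Open Scope R_scope.

Definition R2 : NormedModule R_AbsRing :=
  prod_NormedModule R_AbsRing R_NormedModule R_NormedModule.

Definition dot (x y : R2) : R := fst x * fst y + snd x * snd y.

(* Action on column vectors of J = [0 -1; 1 0] and of its transpose. *)
Definition J_mul (z : R2) : R2 := (- snd z, fst z).
Definition Jtr_mul (z : R2) : R2 := (snd z, - fst z).

Record converter := Converter {
  C_dc : R; G_dc : R; L_f : R; R_f : R; C_f : R; G_f : R;
  eta : R; K_p : R; i_dcref : R; v_dcref : R; mu : R }.

(* No condition on G_dc: it is taken positive in some results and zero in
   others. *)
Definition admissible (p : converter) : Prop :=
  0 < C_dc p /\ 0 < L_f p /\ 0 < R_f p /\ 0 < C_f p /\ 0 < G_f p /\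
  0 < eta p /\ 0 < K_p p /\ 0 < i_dcref p /\ 0 < v_dcref p /\
  0 < mu p /\ mu p <= 1.

Definition m_ab (p : converter) (th : R) : R2 :=
  scal (mu p) ((- sin th, cos th) : R2).

Definition i_dc (p : converter) (v : R) : R :=
  i_dcref p - K_p p * (v - v_dcref p).

Definition i_0 (p : converter) : R := i_dcref p + K_p p * v_dcref p.

Definition P_dc (p : converter) : R := v_dcref p * i_dcref p.

(* The angle on the circle is represented by a real-valued lift; it enters
   the equations only through sin and cos. The load current i_l is a free
   exogenous signal. *)
Definition is_solution (p : converter) (theta v_dc : R -> R)
    (i_ab v_ab i_l : R -> R2) : Prop :=
  forall t : R,
    is_derive theta t (eta p * v_dc t) /\
    (exists dv : R, is_derive v_dc t dv /\
       C_dc p * dv = - G_dc p * v_dc t + i_dc p (v_dc t)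
                     - / 2 * dot (m_ab p (theta t)) (i_ab t)) /\
    (exists di : R2, is_derive i_ab t di /\
       scal (L_f p) di =
         plus (minus (scal (- R_f p) (i_ab t)) (v_ab t))
              (scal (/ 2 * v_dc t) (m_ab p (theta t)))) /\
    (exists dv : R2, is_derive v_ab t dv /\
       scal (C_f p) dv =
         minus (plus (scal (- G_f p) (v_ab t)) (i_ab t)) (i_l t)).

Definition sinusoidal (w : R) (z : R -> R2) : Prop :=
  forall t : R, is_derive z t (scal w (J_mul (z t))).

Definition is_steady_state (p : converter) (theta v_dc : R -> R)
    (i_ab v_ab i_l : R -> R2) (vs : R) : Prop :=
  is_solution p theta v_dc i_ab v_ab i_l /\
  (forall t, v_dc t = vs) /\
  (forall t, is_derive theta t (eta p * vs)) /\
  sinusoidal (eta p * vs) i_ab /\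
  sinusoidal (eta p * vs) v_ab /\
  sinusoidal (eta p * vs) i_l.

Definition v_x (p : converter) (theta v_dc : R -> R) (t : R) : R2 :=
  scal (/ 2 * v_dc t) (m_ab p (theta t)).

(* The sign of v_dc is not restricted, so r is a signed amplitude.
   (r, w, P, Q) are the amplitude, frequency, active and reactive power at the
   switching node in some steady state, for some load current. *)
Definition steady_values (p : converter) (r w P Q : R) : Prop :=
  exists (theta v_dc : R -> R) (i_ab v_ab i_l : R -> R2) (vs : R),
    is_steady_state p theta v_dc i_ab v_ab i_l vs /\
    r = / 2 * mu p * vs /\
    w = eta p * vs /\
    (forall t, P = dot (v_x p theta v_dc t) (i_ab t)) /\
    (forall t, Q = dot (v_x p theta v_dc t) (Jtr_mul (i_ab t))).

(* d is dP_x/dw_x at w: the pairs (w_x, P_x) taken by the steady states, for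
   fixed parameters and free load, form the graph of a function P_x of w_x,
   whose derivative at w is d. Likewise for the amplitude. *)
Definition is_freq_droop (p : converter) (w d : R) : Prop :=
  exists f : R -> R,
    (forall w' P, (exists r Q, steady_values p r w' P Q) <-> P = f w') /\
    is_derive f w d.

Definition is_amp_droop (p : converter) (r d : R) : Prop :=
  exists f : R -> R,
    (forall r' P, (exists w Q, steady_values p r' w P Q) <-> P = f r') /\
    is_derive f r d.

Definition droop_ratio (pi pj : converter) (rho w : R) : Prop :=
  exists di dj : R,
    is_freq_droop pi w di /\ is_freq_droop pj w dj /\ di = rho * dj.

Definition power_sharing (Pi Pj rho : R) : Prop := Pj <> 0 /\ Pi / Pj = rho.

(* Main.v *)
Require Import Defs.
From Stdlib Require Import Reals Lra.
From Coquelicot Require Import Coquelicot.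
Open Scope R_scope.

(** At a steady state the DC-link voltage is a constant [vs], so the capacitor
    current vanishes and the DC balance fixes the current drawn by the bridge.
    Multiplying that current by [vs] turns it into the switching-node power,
    since [v_x] is [vs / 2] times the modulation vector.  Hence
      [P = vs * (i_0 - (G_dc + K_p) * vs)],
    and everything else is read off this one parabola
    ([steady_values_parabola]).  Solving it for [vs] gives the nose curves;
    differentiating it, after the linear changes of variable [vs = w / eta] and
    [vs = 2 * r / mu], gives the droop coefficients; and at a common frequency
    and gain both converters have the same [vs], so that the ratio of their
    powers is that of their currents [i_0 - K_p * vs].

    Conversely every point of the parabola is attained
    ([steady_values_exist]).  In the frame rotating at the speed [eta * vs] the
    DC balance only constrains the component of the AC current along the
    modulation vector.  The quadrature component is arbitrary, the filter
    equations then determine the capacitor voltage and the load current, and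
    the reactive power is proportional to the quadrature component: this is why
    it is unrelated to amplitude and frequency as long as [vs <> 0].  It is
    also what makes the set of pairs (frequency, power) the full graph of a
    function on the real line, so that this function, and with it the droop
    coefficient, is unique.

    For the equivalence of the two power-sharing criteria, the reference
    voltages being equal, the ratio of the [P_dc] is that of the [i_dcref].
    Given this, the droop condition at a frequency [w] says
      [(K_p pi - rho * K_p pj) * (eta * v_dcref - 2 * w) = 0],
    which settles the gains except at [w = eta * v_dcref / 2]; a
    condition holding on a neighbourhood of [w] can be used at a nearby
    frequency instead. *)

(** * Rotating vectors *)

(** The solution of [z' = w J z] starting from [z0], i.e. [exp (w t J) z0]. *)
Definition rotating (w : R) (z0 : R2) (t : R) : R2 :=
  (fst z0 * cos (w * t) - snd z0 * sin (w * t),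
   fst z0 * sin (w * t) + snd z0 * cos (w * t)).

Lemma is_derive_pair (f g : R -> R) (t df dg : R) :
  is_derive f t df -> is_derive g t dg ->
  is_derive (fun s => (f s, g s) : R2) t ((df, dg) : R2).
Proof.
  intros Hf Hg.
  apply (is_derive_ext
    (fun s => plus (scal (f s) ((1, 0) : R2)) (scal (g s) ((0, 1) : R2)))).
  { intros s; apply injective_projections; cbn; ring. }
  replace ((df, dg) : R2)
    with (plus (scal df ((1, 0) : R2)) (scal dg ((0, 1) : R2))).
  2: { apply injective_projections; cbn; ring. }
  apply (is_derive_plus (V := R2));
    apply (is_derive_scal_l (V := R2)); assumption.
Qed.

Lemma rotating_sinusoidal (w : R) (z0 : R2) : sinusoidal w (rotating w z0).
Proof.
  destruct z0 as [x y]; intros t.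
  replace (scal w (J_mul (rotating w (x, y) t)))
    with ((w * - (x * sin (w * t) + y * cos (w * t)),
           w * (x * cos (w * t) - y * sin (w * t))) : R2)
    by (apply injective_projections; cbn; ring).
  (* [ring] needs the components at type [R] itself. *)
  change R in x, y.
  unfold rotating; cbn [fst snd].
  apply is_derive_pair; auto_derive; trivial; ring.
Qed.

(** * The steady-state power parabola *)

Lemma steady_values_parabola (p : converter) (r w P Q : R) :
  steady_values p r w P Q ->
  exists vs : R, r = / 2 * mu p * vs /\ w = eta p * vs /\
    P = vs * (i_0 p - (G_dc p + K_p p) * vs).
Proof.
  intros (theta & v_dc & i_ab & v_ab & i_l & vs
            & (Hsol & Hv & _) & Hr & Hw & HP & _).
  exists vs; repeat split; trivial.
  destruct (Hsol 0) as (_ & (dv & Hdv & Hbal) & _).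
  assert (Hdv0 : dv = 0).
  { rewrite <- (is_derive_unique _ _ _ Hdv).
    rewrite (Derive_ext _ (fun _ => vs)) by exact Hv.
    apply Derive_const. }
  specialize (HP 0).
  rewrite Hv, Hdv0 in Hbal.
  unfold v_x in HP; rewrite Hv in HP.
  assert (Hdot : dot (scal (/ 2 * vs) (m_ab p (theta 0))) (i_ab 0)
                 = vs * (/ 2 * dot (m_ab p (theta 0)) (i_ab 0)))
    by (unfold dot; cbn; ring).
  rewrite HP, Hdot.
  f_equal.
  unfold i_dc in Hbal; unfold i_0; lra.
Qed.

(** The load current is free and the DC balance is a single scalar equation, so
    the voltage [vs] and the quadrature current [b] can be prescribed: the
    in-phase current solves the DC balance, and the filter equations are then solved
    for the capacitor voltage and the load current. *)
Lemma steady_values_exist (p : converter) (vs b : R) :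
  mu p <> 0 ->
  steady_values p (/ 2 * mu p * vs) (eta p * vs)
    (vs * (i_0 p - (G_dc p + K_p p) * vs)) (/ 2 * mu p * vs * b).
Proof.
  intros Hmu.
  set (w := eta p * vs).
  set (a := 2 * (i_0 p - (G_dc p + K_p p) * vs) / mu p).
  (* Initial values: the modulation vector starts at [mu * (0, 1)], so that
     [a] is the current in phase with it and [b] the one along [J (0, 1)]. *)
  set (i0 := (- b, a) : R2).
  set (v0 := (- R_f p * fst i0 + L_f p * w * snd i0,
              / 2 * vs * mu p - R_f p * snd i0 - L_f p * w * fst i0) : R2).
  set (l0 := (fst i0 - G_f p * fst v0 + C_f p * w * snd v0,
              snd i0 - G_f p * snd v0 - C_f p * w * fst v0) : R2).
  assert (Hm : forall t, dot (m_ab p (w * t)) (rotating w i0 t) = mu p * a).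
  { intros t.
    transitivity (mu p * a * ((sin (w * t))² + (cos (w * t))²)).
    - unfold dot, Rsqr; cbn; ring.
    - rewrite sin2_cos2; ring. }
  assert (Htheta : forall t, is_derive (fun t => w * t) t w)
    by (intros t; auto_derive; trivial; ring).
  exists (fun t => w * t), (fun _ => vs),
    (rotating w i0), (rotating w v0), (rotating w l0), vs.
  split; [split; [|split; [|split; [|split; [|split]]]]
         | split; [|split; [|split]]];
    try apply rotating_sinusoidal; trivial.
  - intros t; split; [apply Htheta | split; [|split]].
    + exists 0; split; [apply (is_derive_const (V := R_NormedModule)) |].
      rewrite Hm; unfold a, i_dc, i_0; field; exact Hmu.
    + eexists; split; [apply rotating_sinusoidal |].
      apply injective_projections; cbn; ring.
    + eexists; split; [apply rotating_sinusoidal |].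
      apply injective_projections; cbn; ring.
  - intros t.
    transitivity (/ 2 * vs * dot (m_ab p (w * t)) (rotating w i0 t)).
    + rewrite Hm; unfold a; field; exact Hmu.
    + unfold dot; cbn; ring.
  - intros t.
    transitivity (/ 2 * mu p * vs * b * ((sin (w * t))² + (cos (w * t))²)).
    + rewrite sin2_cos2; ring.
    + unfold dot, Rsqr; cbn; ring.
Qed.

(** * Nose curves *)

Lemma quadratic_root (a b P x : R) :
  0 < a -> P = x * (b - a * x) ->
  0 <= b ^ 2 - 4 * a * P /\
  exists s : R, (s = 1 \/ s = -1) /\
    x = / (2 * a) * (b + s * sqrt (b ^ 2 - 4 * a * P)).
Proof.
  intros Ha ->.
  replace (b ^ 2 - 4 * a * (x * (b - a * x))) with (Rsqr (2 * a * x - b))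
    by (unfold Rsqr; ring).
  split; [apply Rle_0_sqr |].
  rewrite sqrt_Rsqr_abs.
  destruct (Rle_lt_dec 0 (2 * a * x - b)) as [H | H].
  - exists 1; split; [left; trivial |].
    rewrite Rabs_pos_eq by exact H; field; lra.
  - exists (-1); split; [right; trivial |].
    rewrite Rabs_left by exact H; field; lra.
Qed.

Lemma nose_curve (p : converter) (r w P Q : R) :
  0 < mu p -> 0 < G_dc p + K_p p -> steady_values p r w P Q ->
  0 <= i_0 p ^ 2 - 4 * (G_dc p + K_p p) * P /\
  (exists s : R, (s = 1 \/ s = -1) /\
     r = mu p / (4 * (G_dc p + K_p p)) *
         (i_0 p + s * sqrt (i_0 p ^ 2 - 4 * (G_dc p + K_p p) * P)) /\
     w = eta p / (2 * (G_dc p + K_p p)) *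
         (i_0 p + s * sqrt (i_0 p ^ 2 - 4 * (G_dc p + K_p p) * P))) /\
  w = 2 * eta p / mu p * r.
Proof.
  intros Hmu Ha Hs.
  destruct (steady_values_parabola _ _ _ _ _ Hs) as (vs & -> & -> & HP).
  destruct (quadratic_root _ _ _ _ Ha HP) as (Hdisc & s & Hs1 & Hvs).
  split; [exact Hdisc | split].
  - exists s; split; [exact Hs1 |].
    set (rt := sqrt _) in *.
    rewrite Hvs; split; field; lra.
  - field; lra.
Qed.

Lemma reactive_power_free (p : converter) (r w Q : R) :
  0 < mu p -> r <> 0 -> w = 2 * eta p / mu p * r ->
  exists P : R, steady_values p r w P Q.
Proof.
  intros Hmu Hr ->.
  assert (H := steady_values_exist p (2 * r / mu p) (Q / r) (Rgt_not_eq _ _ Hmu)).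
  replace (/ 2 * mu p * (2 * r / mu p)) with r in H by (field; lra).
  replace (eta p * (2 * r / mu p)) with (2 * eta p / mu p * r) in H
    by (field; lra).
  replace (r * (Q / r)) with Q in H by (field; exact Hr).
  eexists; exact H.
Qed.

(** * Droop coefficients *)

(** A relation which is the graph of [g] is the graph of no other function, so
    its slope is well defined. *)
Lemma graph_slope (rel : R -> R -> Prop) (g : R -> R) (x l d : R) :
  (forall x' P, rel x' P <-> P = g x') -> is_derive g x l ->
  ((exists f : R -> R,
      (forall x' P, rel x' P <-> P = f x') /\ is_derive f x d) <-> d = l).
Proof.
  intros Hg Hl; split.
  - intros (f & Hf & Hd).
    rewrite <- (is_derive_unique _ _ _ Hd), <- (is_derive_unique _ _ _ Hl).
    apply Derive_ext; intros t.
    apply Hg, Hf; reflexivity.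
  - intros ->; exists g; split; assumption.
Qed.

(** The quadrature current can be taken zero, whatever [vs]; in particular the
    parabola has no hole at [w = 0]. *)
Lemma freq_droop_iff (p : converter) (w d : R) :
  0 < mu p -> 0 < eta p ->
  is_freq_droop p w d <->
    d = - (2 * (G_dc p + K_p p) / eta p ^ 2) * w + i_0 p / eta p.
Proof.
  intros Hmu Heta.
  apply (graph_slope _
    (fun w => w / eta p * (i_0 p - (G_dc p + K_p p) * (w / eta p)))).
  - intros w' P; split.
    + intros (r & Q & Hs).
      destruct (steady_values_parabola _ _ _ _ _ Hs) as (vs & _ & -> & ->).
      field; lra.
    + intros ->.
      assert (H := steady_values_exist p (w' / eta p) 0 (Rgt_not_eq _ _ Hmu)).
      replace (eta p * (w' / eta p)) with w' in H by (field; lra).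
      do 2 eexists; exact H.
  - auto_derive; trivial; field; lra.
Qed.

Lemma amp_droop_iff (p : converter) (r d : R) :
  0 < mu p ->
  is_amp_droop p r d <->
    d = - (8 * (G_dc p + K_p p) / mu p ^ 2) * r + 2 * i_0 p / mu p.
Proof.
  intros Hmu.
  apply (graph_slope _
    (fun r => 2 * r / mu p * (i_0 p - (G_dc p + K_p p) * (2 * r / mu p)))).
  - intros r' P; split.
    + intros (w & Q & Hs).
      destruct (steady_values_parabola _ _ _ _ _ Hs) as (vs & -> & _ & ->).
      field; lra.
    + intros ->.
      assert (H := steady_values_exist p (2 * r' / mu p) 0 (Rgt_not_eq _ _ Hmu)).
      replace (/ 2 * mu p * (2 * r' / mu p)) with r' in H by (field; lra).
      do 2 eexists; exact H.
  - auto_derive; trivial; field; lra.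
Qed.

(** * Power sharing *)

Lemma power_sharing_of_gains (pi pj : converter) (rho w ri Pi Qi rj Pj Qj : R) :
  G_dc pi = 0 -> G_dc pj = 0 -> v_dcref pi = v_dcref pj ->
  eta pi = eta pj -> eta pj <> 0 ->
  steady_values pi ri w Pi Qi -> steady_values pj rj w Pj Qj -> Pj <> 0 ->
  K_p pi = rho * K_p pj -> i_dcref pi = rho * i_dcref pj ->
  power_sharing Pi Pj rho.
Proof.
  intros HGi HGj Hv He He0 Hi Hj HPj HK Hr.
  destruct (steady_values_parabola _ _ _ _ _ Hi) as (vi & _ & Hwi & HPi).
  destruct (steady_values_parabola _ _ _ _ _ Hj) as (vj & _ & Hwj & HPj').
  assert (Hvv : vi = vj).
  { apply (Rmult_eq_reg_l (eta pj)); [| exact He0].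
    rewrite <- Hwj, Hwi, He; reflexivity. }
  assert (HPij : Pi = rho * Pj).
  { rewrite HPi, HPj', Hvv; unfold i_0; rewrite HGi, HGj, Hv, HK, Hr; ring. }
  split; [exact HPj |].
  rewrite HPij; field; exact HPj.
Qed.

(** Both the slope and, through [i_0], the constant term of the affine function
    of [w] giving the droop coefficient contain [K_p].  Collecting the gain
    mismatch in front makes visible the one frequency at which it cancels. *)
Lemma droop_ratio_iff (pi pj : converter) (rho w : R) :
  0 < mu pi -> 0 < mu pj -> G_dc pi = 0 -> G_dc pj = 0 ->
  v_dcref pi = v_dcref pj -> eta pi = eta pj -> 0 < eta pj ->
  droop_ratio pi pj rho w <->
    (K_p pi - rho * K_p pj) * (eta pj * v_dcref pj - 2 * w)
      + eta pj * (i_dcref pi - rho * i_dcref pj) = 0.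
Proof.
  intros Hmi Hmj HGi HGj Hv He He0.
  assert (Hei : 0 < eta pi) by (rewrite He; exact He0).
  set (di := - (2 * (G_dc pi + K_p pi) / eta pi ^ 2) * w + i_0 pi / eta pi).
  set (dj := - (2 * (G_dc pj + K_p pj) / eta pj ^ 2) * w + i_0 pj / eta pj).
  assert (Hdiff : (K_p pi - rho * K_p pj) * (eta pj * v_dcref pj - 2 * w)
      + eta pj * (i_dcref pi - rho * i_dcref pj)
      = eta pj ^ 2 * (di - rho * dj)).
  { unfold di, dj, i_0; rewrite HGi, HGj, Hv, He; field; lra. }
  rewrite Hdiff; split.
  - intros (di' & dj' & Hdi & Hdj & Heq).
    apply freq_droop_iff in Hdi; trivial.
    apply freq_droop_iff in Hdj; trivial.
    fold di in Hdi; fold dj in Hdj.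
    rewrite <- Hdi, <- Hdj, Heq; ring.
  - intros H0; exists di, dj; repeat split.
    + apply freq_droop_iff; trivial.
    + apply freq_droop_iff; trivial.
    + apply Rmult_integral in H0 as [H0 | H0]; [| lra].
      exfalso; exact (pow_nonzero (eta pj) 2 (Rgt_not_eq _ _ He0) H0).
Qed.

Lemma P_dc_ratio_iff (pi pj : converter) (rho : R) :
  v_dcref pi = v_dcref pj -> v_dcref pj <> 0 ->
  P_dc pi = rho * P_dc pj <-> i_dcref pi = rho * i_dcref pj.
Proof.
  intros Hv H0; unfold P_dc; rewrite Hv; split.
  - intros H; apply (Rmult_eq_reg_l (v_dcref pj)); [| exact H0].
    rewrite H; ring.
  - intros ->; ring.
Qed.

Lemma gains_iff_droop_ratio (pi pj : converter) (rho w : R) :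
  0 < mu pi -> 0 < mu pj -> G_dc pi = 0 -> G_dc pj = 0 ->
  v_dcref pi = v_dcref pj -> v_dcref pj <> 0 ->
  eta pi = eta pj -> 0 < eta pj ->
  w <> eta pj * v_dcref pj / 2 ->
  (K_p pi = rho * K_p pj /\ i_dcref pi = rho * i_dcref pj <->
     droop_ratio pi pj rho w /\ P_dc pi = rho * P_dc pj).
Proof.
  intros Hmi Hmj HGi HGj Hv Hv0 He He0 Hw.
  rewrite P_dc_ratio_iff by assumption.
  rewrite droop_ratio_iff by assumption.
  split; intros [H Hr]; split; trivial.
  - rewrite H, Hr; ring.
  - rewrite Hr in H.
    assert (Hprod : (K_p pi - rho * K_p pj) * (eta pj * v_dcref pj - 2 * w) = 0)
      by lra.
    apply Rmult_integral in Hprod as [Hk | Hk]; lra.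
Qed.

Lemma locally_exists_neq (w c : R) (A : R -> Prop) :
  locally w A -> exists w', A w' /\ w' <> c.
Proof.
  intros HA.
  destruct (Req_dec w c) as [-> | Hw].
  - destruct HA as [eps HA].
    assert (He := cond_pos eps).
    exists (c + eps / 2); split; [| lra].
    apply HA.
    change (Rabs (c + eps / 2 - c) < eps).
    rewrite Rabs_pos_eq; lra.
  - exists w; split; [exact (locally_singleton _ _ HA) | exact Hw].
Qed.

Theorem proposition5 :
  (* Nose curves *)
  (forall p : converter, admissible p -> 0 < G_dc p ->
    (forall r w P Q : R, steady_values p r w P Q ->
       0 <= i_0 p ^ 2 - 4 * (G_dc p + K_p p) * P /\
       (exists s : R, (s = 1 \/ s = -1) /\
          r = mu p / (4 * (G_dc p + K_p p)) *
              (i_0 p + s * sqrt (i_0 p ^ 2 - 4 * (G_dc p + K_p p) * P)) /\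
          w = eta p / (2 * (G_dc p + K_p p)) *
              (i_0 p + s * sqrt (i_0 p ^ 2 - 4 * (G_dc p + K_p p) * P))) /\
       w = 2 * eta p / mu p * r) /\
    (forall r w Q : R, r <> 0 -> w = 2 * eta p / mu p * r ->
       exists P : R, steady_values p r w P Q)) /\
  (* Droop behavior *)
  (forall p : converter, admissible p -> 0 < G_dc p ->
    forall r w P Q : R, steady_values p r w P Q ->
      (forall d : R, is_freq_droop p w d <->
         d = - (2 * (G_dc p + K_p p) / eta p ^ 2) * w + i_0 p / eta p) /\
      (forall d : R, is_amp_droop p r d <->
         d = - (8 * (G_dc p + K_p p) / mu p ^ 2) * r + 2 * i_0 p / mu p)) /\
  (* Power sharing *)
  (forall (pi pj : converter) (rho w ri Pi Qi rj Pj Qj : R),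
    admissible pi -> admissible pj -> G_dc pi = 0 -> G_dc pj = 0 ->
    v_dcref pi = v_dcref pj -> eta pi = eta pj -> 0 < rho ->
    steady_values pi ri w Pi Qi -> steady_values pj rj w Pj Qj -> Pj <> 0 ->
    (K_p pi = rho * K_p pj /\ i_dcref pi = rho * i_dcref pj ->
       power_sharing Pi Pj rho) /\
    (K_p pi = rho * K_p pj /\ i_dcref pi = rho * i_dcref pj <->
       locally w (droop_ratio pi pj rho) /\ P_dc pi = rho * P_dc pj) /\
    (w <> eta pj * v_dcref pj / 2 ->
       (K_p pi = rho * K_p pj /\ i_dcref pi = rho * i_dcref pj <->
          droop_ratio pi pj rho w /\ P_dc pi = rho * P_dc pj))).
Proof.
  split; [| split].
  - intros p (_ & _ & _ & _ & _ & _ & HK & _ & _ & Hmu & _) HG; split.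
    + intros r w P Q; apply nose_curve; lra.
    + intros r w Q; apply reactive_power_free; exact Hmu.
  - intros p (_ & _ & _ & _ & _ & Heta & _ & _ & _ & Hmu & _) _ r w P Q _.
    split; intros d; [apply freq_droop_iff | apply amp_droop_iff]; assumption.
  - intros pi pj rho w ri Pi Qi rj Pj Qj
      (_ & _ & _ & _ & _ & _ & _ & _ & _ & Hmi & _)
      (_ & _ & _ & _ & _ & He0 & _ & _ & Hv0 & Hmj & _)
      HGi HGj Hv He _ Hi Hj HPj.
    assert (Hv0' := Rgt_not_eq _ _ Hv0).
    split; [| split].
    + intros [HK Hr].
      eapply (power_sharing_of_gains pi pj); eauto using Rgt_not_eq.
    + split.
      * intros [HK Hr]; split.
        -- apply filter_forall; intros w'.
           apply droop_ratio_iff; trivial.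
           rewrite HK, Hr; ring.
        -- apply P_dc_ratio_iff; assumption.
      * intros [Hloc HP].
        destruct (locally_exists_neq _ (eta pj * v_dcref pj / 2) _ Hloc)
          as (w' & Hw' & Hne).
        apply (gains_iff_droop_ratio pi pj rho w'); auto.
    + apply gains_iff_droop_ratio; assumption.
Qed.
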